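(* Let $q$ be one of the four numbers $$\frac{\sqrt{3}-1}{2},\qquad \frac{3-\sqrt{5}}{2},\qquad \sqrt{2}-1,\qquad \frac{\sqrt{5}-1}{2},$$ and put $Q=\frac{q}{1-q}$. Let $\delta$ be a positive real number and let $I$ be one of the intervals $(-Q,-Q+\delta)$, $(Q-\delta,Q)$. Then the zero function is the only solution $f:\mathbb{R}\to\mathbb{R}$ of Schilling's problem (for this $q$) such that at each point of $I$ the function $f$ is either right-continuous or left-continuous.
   Context: For a fixed real number $q\in(0,1)$, a solution of Schilling's problem is a function $f:\mathbb{R}\to\mathbb{R}$ (no regularity is assumed) such that $$f(qx)=\frac{1}{4q}\,[f(x-1)+f(x+1)+2f(x)]\quad\text{for all } x\in\mathbb{R},$$ and $$f(x)=0\quad\text{for all } x\in\mathbb{R}\text{ with } |x|>\frac{q}{1-q}.$$ A function $f$ is right-continuous (respectively left-continuous) at $x_0$ if $f(x)\to f(x_0)$ as $x\to x_0$ with $x>x_0$ (respectively $x<x_0$). *)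

(* Defs.v *)
From mathcomp Require Import all_boot all_order all_algebra.
From mathcomp Require Import all_classical all_reals all_analysis.
Import Order.TTheory GRing.Theory Num.Theory numFieldNormedType.Exports.

Set Implicit Arguments.
Unset Strict Implicit.
Unset Printing Implicit Defensive.

Local Open Scope classical_set_scope.
Local Open Scope ring_scope.

Definition schilling_solution (R : realType) (q : R) (f : R -> R) : Prop :=
  (forall x : R, f (q * x) = (4 * q)^-1 * (f (x - 1) + f (x + 1) + 2 * f x)) /\
  (forall x : R, q / (1 - q) < `|x| -> f x = 0).

(* The filters [a^'+] and [a^'-] exclude the point [a] itself. *)
Definition right_continuous_at (R : realType) (f : R -> R) (a : R) : Prop :=
  f x @[x --> a^'+] --> f a.

Definition left_continuous_at (R : realType) (f : R -> R) (a : R) : Prop :=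
  f x @[x --> a^'-] --> f a.

(* Main.v *)
Require Import Defs.
From mathcomp Require Import all_boot all_order all_algebra.
From mathcomp Require Import all_classical all_reals all_analysis.
From mathcomp Require Import ring lra zify.
Import Order.TTheory GRing.Theory Num.Theory numFieldNormedType.Exports.

(** Put [r = 1/q].  For the four values of [q] the number [r] is a quadratic
    Pisot number: it is an irrational algebraic integer with [1 < r], and its
    conjugate [r'] satisfies [`|r'| < 1].

    At the points of the ring [Z[r]] the equation reads
    [4 f(y) = r (f(r y - 1) + f(r y + 1) + 2 f(r y))].  The maps
    [y |-> r y + e] preserve [Z[r]], and on conjugates they act as the
    contractions [y' |-> r' y' + e].  Hence, for large [K], they can leave the
    set of the [y] in [Z[r]] with [`|y| <= Q] and [`|y'| <= K] only through
    points with [Q < `|y|], where [f] vanishes.  This set is finite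
    ([quad_box_finite]), so the values of [f] on it solve a linear system
    [4 v = r A v], where the matrix [A] has integer entries and absolute row
    sums at most 4.  If [v] were nonzero, the determinant of [4 - r A] would
    vanish; it lies in [Z[r]], so the determinant of [4 - r' A] would vanish as
    well ([det_conjugate]), which is absurd: the maximum norm of [r' A] is less
    than 4 ([contracting_system]).  So every solution, however irregular,
    vanishes on [Z[r]] ([vanish_on_quad]).

    As [Z[r]] is dense ([quad_dense]), one-sided continuity makes [f] vanish on
    the whole interval.  Finally, zeros spread inwards from an end of the
    support ([schilling_push]): if [f] is zero on the right of [Q - u], solving
    the equation for [f(x - 1)] shows that it is zero on the right of
    [Q - u / q] and of [Q - u - 1], whichever is nearer to [Q]; after finitely
    many steps this reaches any given point.  The reflection [x |-> - x]
    exchanges the two ends. *)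

Local Open Scope classical_set_scope.
Local Open Scope ring_scope.

Set Implicit Arguments.
Unset Strict Implicit.

(** * Conjugation in a quadratic ring *)

Definition quad (R : pzRingType) (z : R) (p : int * int) : R :=
  p.1%:~R + p.2%:~R * z.

(** Integral independence of [1] and [z]: it makes the coordinates of an
    element of [Z[z]] unique, so that conjugation is well defined. *)
Definition quad_free (R : pzRingType) (z : R) :=
  forall p : int * int, quad z p = 0 -> p = (0, 0).

(** Conjugation without field automorphisms: reducing an integer polynomial
    modulo [X^2 - c X - d] yields one pair of coordinates that serves both
    roots. *)
Lemma horner_quadratic (R : comNzRingType) (c d : int) (P : {poly int}) :
  exists p : int * int, forall z : R, z ^+ 2 = c%:~R * z + d%:~R ->
    (map_poly intr P).[z] = quad z p.
Proof.
elim/poly_ind: P => [|P e [[a b] IH]].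
  by exists (0, 0) => z _; rewrite rmorph0 horner0 /quad /=; ring.
exists (b * d + e, a + b * c) => z hz.
rewrite rmorphD rmorphM /= map_polyX map_polyC /= !hornerE IH // /quad /=.
have -> : (a%:~R + b%:~R * z) * z = a%:~R * z + b%:~R * z ^+ 2 :> R by ring.
rewrite hz; ring.
Qed.

(** The pencil [k - X A] over the integer polynomials: its determinant is the
    integer polynomial that [horner_quadratic] needs. *)
Definition pencil n (k : int) (A : 'M[int]_n) : 'M[{poly int}]_n :=
  k%:P%:M - 'X *: map_mx polyC A.

Lemma det_pencil (R : comNzRingType) n (k : int) (A : 'M[int]_n) (z : R) :
  (map_poly intr (\det (pencil k A))).[z]
  = \det (k%:~R%:M - z *: map_mx intr A).
Proof.
rewrite -[LHS]/(horner_eval z _) -!det_map_mx; congr (\det _).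
apply/matrixP => i j; rewrite !mxE rmorphB rmorphM rmorphMn /= map_polyX !map_polyC /=.
by rewrite /horner_eval !hornerE hornerMn !hornerE.
Qed.

(** At an index where [`|v t|] is maximal the system gives
    [k `|v t| <= `|z| k `|v t|]. *)
Lemma contracting_system (R : realFieldType) (T : finType) (k : nat)
    (A : T -> T -> int) (z : R) (v : T -> R) :
  (0 < k)%N -> `|z| < 1 -> (forall t, \sum_s `|A t s| <= k%:Z) ->
  (forall t, k%:R * v t = z * \sum_s (A t s)%:~R * v s) -> forall t, v t = 0.
Proof.
move=> k0 z1 Ak hv t0.
have [t _ tmax] := @arg_maxP _ R T t0 predT (fun t => `|v t|) isT.
have {}tmax s : `|v s| <= `|v t| by exact: tmax.
suff : `|v t| <= 0 by move=> h; apply/eqP; rewrite -normr_le0 (le_trans (tmax t0)).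
have : k%:R * `|v t| <= `|z| * (k%:R * `|v t|).
  rewrite -{1}[k%:R]ger0_norm ?ler0n // -normrM hv normrM ler_wpM2l //.
  apply: (le_trans (ler_norm_sum _ _ _)).
  apply: (@le_trans _ _ (\sum_s (`|A t s|)%:~R * `|v t|)).
    by apply: ler_sum => s _; rewrite normrM -intr_norm ler_wpM2l // tmax.
  by rewrite -mulr_suml -rmorph_sum /= ler_wpM2r // -[k%:R]/((k%:Z)%:~R) ler_int.
rewrite -[_ <= 0](pmulr_rle0 _ (_ : (0 : R) < k%:R)) ?ltr0n //.
by move: (_ * `|v t|) z1 => x; nra.
Qed.

Section Conjugate.
Variables (R : realFieldType) (r r' : R) (c d : int).
Hypothesis rE : r ^+ 2 = c%:~R * r + d%:~R.
Hypothesis r'E : r' ^+ 2 = c%:~R * r' + d%:~R.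
Hypothesis r_free : quad_free r.

Lemma det_conjugate n (k : int) (A : 'M[int]_n) :
  \det (k%:~R%:M - r *: map_mx intr A) = 0 ->
  \det (k%:~R%:M - r' *: map_mx intr A) = 0.
Proof.
have [p hp] := @horner_quadratic R c d (\det (pencil k A)).
by rewrite -!det_pencil !hp // => /r_free ->; rewrite /quad /=; ring.
Qed.

(** A nonzero solution for [r] would, by conjugating the determinant, give a
    nonzero solution for [r'], against [contracting_system]. *)
Lemma system_trivial (T : finType) (k : nat) (A : T -> T -> int) (v : T -> R) :
  (0 < k)%N -> `|r'| < 1 -> (forall t, \sum_s `|A t s| <= k%:Z) ->
  (forall t, k%:R * v t = r * \sum_s (A t s)%:~R * v s) -> forall t, v t = 0.
Proof.
move=> k0 r'1 Ak hv t0; apply/eqP; apply: contraT => vt0.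
pose M : 'M[int]_#|T| := \matrix_(i, j) A (enum_val j) (enum_val i).
(* M is the transpose of A, so that the row vectors killed by k - z M are the
   solutions of the system with parameter z *)
have mulME (z : R) (w : 'rV[R]_#|T|) i :
    (w *m (k%:~R%:M - z *: map_mx intr M)) 0 i =
    k%:R * w 0 i - z * \sum_t (A (enum_val i) t)%:~R * w 0 (enum_rank t).
  rewrite mulmxBr mul_mx_scalar -scalemxAr !mxE; congr (_ - _ * _).
  rewrite (reindex _ (onW_bij _ (@enum_rank_bij T))) /=.
  by apply: eq_bigr => t _; rewrite !mxE enum_rankK mulrC.
have /eqP : \det (k%:~R%:M - r *: map_mx intr M) = 0.
  apply/eqP/det0P; exists (\row_i v (enum_val i)).
    by apply: contra vt0 => /eqP/rowP/(_ (enum_rank t0)); rewrite !mxE enum_rankK => ->.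
  apply/rowP => i; rewrite mulME !mxE hv; apply/eqP; rewrite subr_eq0; apply/eqP.
  by congr (_ * _); apply: eq_bigr => t _; rewrite mxE enum_rankK.
move=> /eqP/det_conjugate/eqP/det0P[w /negP w0 wM]; case: w0.
apply/eqP/rowP => i; rewrite mxE -(enum_valK i).
apply: (@contracting_system R T k A r' (fun t => w 0 (enum_rank t))) => // t.
apply/eqP; rewrite -subr_eq0; apply/eqP.
have := mulME r' w (enum_rank t); rewrite wM mxE enum_rankK => <- //.
Qed.

End Conjugate.

(** * Vanishing on the quadratic ring *)

(** Rewrites the value at [p] as a row of a matrix indexed by [s]; the row is
    zero when [p] lies outside [s]. *)
Lemma sum_seq_sub_delta (V : pzRingType) (I : choiceType) (s : seq I) (p : I)
    (g : I -> V) :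
  \sum_(u : seq_sub s) (Posz (val u == p))%:~R * g (val u) = (p \in s)%:R * g p.
Proof.
case: (boolP (p \in s)) => ps; rewrite ?mul1r ?mul0r.
  rewrite (bigD1 (SeqSub ps)) //= eqxx mul1r big1 ?addr0 // => u up.
  by rewrite (negbTE (_ : val u != p)) ?mul0r //.
rewrite big1 // => u _; case: eqP => [up|_]; last by rewrite mul0r.
by rewrite -up (valP u) in ps.
Qed.

Section Lattice.
Variables (R : archiRealFieldType) (r r' : R) (c d : int).
Hypothesis rE : r ^+ 2 = c%:~R * r + d%:~R.
Hypothesis r'E : r' ^+ 2 = c%:~R * r' + d%:~R.

(** The two bounds control both coordinates, because
    [quad r p - quad r' p = p.2 (r - r')]. *)
Lemma quad_box_finite (Q K : R) : r != r' ->
  exists s : seq (int * int), forall p : int * int,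
    (p \in s) = (`|quad r p| <= Q) && (`|quad r' p| <= K).
Proof.
move=> rr'.
pose B := (Q + K) / `|r - r'|.
pose N := Num.bound (`|Q| + `|B| * `|r| + `|B|).
pose zs : seq int := [seq i%:Z - N%:Z | i <- iota 0 (N + N).+1].
pose F (p : int * int) := (`|quad r p| <= Q) && (`|quad r' p| <= K).
have zsP (a : int) : (`|a|%:~R : R) <= `|Q| + `|B| * `|r| + `|B| -> a \in zs.
  move=> h; have : (`|a|%:~R : R) < N%:R.
    by apply: (le_lt_trans h); rewrite archi_boundP // !addr_ge0 // mulr_ge0.
  rewrite -[N%:R]/(N%:Z%:~R) ltr_int => aN.
  have [i iN ->] : exists2 i : nat, (i < (N + N).+1)%N & a = i%:Z - N%:Z.
    by rewrite ltr_norml in aN; exists (absz (a + N%:Z)); lia.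
  by apply/mapP; exists i; rewrite ?mem_iota.
exists [seq p <- [seq (a, b) | a <- zs, b <- zs] | F p] => -[a b].
rewrite mem_filter -/(F (a, b)); case: (boolP (F _)) => //= /andP[h1 h2]; rewrite /quad /= in h1 h2.
have rr0 : 0 < `|r - r'| by rewrite normr_gt0 subr_eq0.
have hb : `|b|%:~R <= `|B|.
  apply: le_trans (ler_norm _); rewrite ler_pdivlMr // intr_norm -normrM.
  have -> : b%:~R * (r - r') = (a%:~R + b%:~R * r) - (a%:~R + b%:~R * r') by ring.
  by apply: (le_trans (ler_normB _ _)); exact: lerD.
have ha : `|a|%:~R <= `|Q| + `|B| * `|r|.
  rewrite intr_norm.
  have -> : a%:~R = (a%:~R + b%:~R * r) - b%:~R * r :> R by ring.
  apply: (le_trans (ler_normB _ _)); apply: lerD; first exact: le_trans (ler_norm _).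
  by rewrite normrM ler_wpM2r // -intr_norm.
apply: (@allpairs_f int int _ pair zs zs a b); apply: zsP.
- by apply: (le_trans ha); rewrite lerDl.
- by apply: (le_trans hb); rewrite lerDr addr_ge0 // mulr_ge0.
Qed.

Hypothesis r_free : quad_free r.
Hypothesis r'_lt1 : `|r'| < 1.
Variables (Q : R) (f : R -> R).
Hypothesis fE : forall y, 4 * f y = r * (f (r * y - 1) + f (r * y + 1) + 2 * f (r * y)).
Hypothesis f_supp : forall y, Q < `|y| -> f y = 0.

Let step (e : int) (p : int * int) : int * int := (p.2 * d + e, p.1 + p.2 * c).

Let quad_step e p (z : R) : z ^+ 2 = c%:~R * z + d%:~R ->
  quad z (step e p) = z * quad z p + e%:~R.
Proof.
move=> zE; rewrite /quad /=.
have -> : z * (p.1%:~R + p.2%:~R * z) = p.1%:~R * z + p.2%:~R * z ^+ 2 by ring.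
by rewrite zE; ring.
Qed.

(** The box is chosen for the given [p]: [K] is at least the size of the
    conjugate of [p], and at least [1 / (1 - `|r'|)] so that the conjugate
    contractions map [[-K, K]] to itself. *)
Lemma vanish_on_quad p : r != r' -> f (quad r p) = 0.
Proof.
move=> rr'.
pose K := Num.max `|quad r' p| (1 - `|r'|)^-1.
have [s sP] := quad_box_finite Q K rr'.
case: (boolP (p \in s)) => [ps|]; last first.
  rewrite sP le_max lexx andbT -ltNge; exact: f_supp.
(* the shift 0 occurs twice, for the coefficient 2 of the equation *)
pose E : seq int := [:: -1; 1; 0; 0].
pose A (t u : seq_sub s) : int := \sum_(e <- E) Posz (val u == step e (val t)).
apply: (system_trivial rE r'E r_free (T := seq_sub s) (k := 4) (A := A)
  (v := fun t => f (quad r (val t))) _ r'_lt1 _ _ (SeqSub ps)) => // t.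
  rewrite (eq_bigr (A t)) => [|u _]; last by rewrite ger0_norm // sumr_ge0.
  rewrite exchange_big /=; apply: (@le_trans _ _ (\sum_(e <- E) 1)); last by rewrite !big_cons big_nil.
  apply: ler_sum => e _.
  have := @sum_seq_sub_delta int _ s (step e (val t)) (fun=> 1).
  rewrite (eq_bigr (fun u => Posz (val u == step e (val t)))) => [->|u _].
    by case: (_ \in _).
  by rewrite mulr1 intz.
rewrite fE; congr (_ * _).
(* a step that leaves the box does so through a point outside the support *)
have stepP e : `|e| <= 1 -> (step e (val t) \in s)%:R * f (quad r (step e (val t)))
    = f (r * quad r (val t) + e%:~R).
  move=> e1; rewrite -quad_step //; case: (boolP (_ \in s)) => hs; first by rewrite mul1r.
  rewrite mul0r f_supp // ltNge; apply: contra hs => hQ; rewrite sP hQ quad_step //=.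
  have := valP t; rewrite /= sP => /andP[_ hK].
  have r'0 : 0 < 1 - `|r'| by rewrite subr_gt0.
  have : 1 <= K * (1 - `|r'|) by rewrite -ler_pdivrMr // mul1r /K le_max lexx orbT.
  have : `|e%:~R : R| <= 1 by rewrite -intr_norm -[1]/(1%:~R) ler_int.
  have := ler_normD (r' * quad r' (val t)) e%:~R.
  rewrite normrM; have := ler_wpM2l (normr_ge0 r') hK.
  lra.
transitivity (\sum_(e <- E) f (r * quad r (val t) + e%:~R)).
  rewrite !big_cons big_nil /= rmorph0 !addr0 rmorphN rmorph1; ring.
transitivity (\sum_(e <- E) (step e (val t) \in s)%:R * f (quad r (step e (val t)))).
  by rewrite !big_cons !big_nil !stepP.
rewrite (eq_bigr _ (fun e _ => esym (sum_seq_sub_delta s (step e (val t))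
  (fun p => f (quad r p))))).
rewrite exchange_big /=; apply: eq_bigr => u _.
by rewrite /A rmorph_sum /= mulr_suml.
Qed.

End Lattice.

(** * Density and irrationality *)

(** High powers of the fractional part of [r] are positive elements of [Z[r]]
    that are shorter than the interval, so that some multiple falls in it. *)
Lemma quad_dense (R : realType) (r : R) (c d : int) :
  r ^+ 2 = c%:~R * r + d%:~R -> quad_free r ->
  forall x y : R, x < y -> exists p, x < quad r p < y.
Proof.
move=> rE r_free x y xy.
pose s := r - (Num.floor r)%:~R.
have /andP[fl1 fl2] := floor_itv r; rewrite intrD rmorph1 in fl2.
have s0 : 0 < s.
  rewrite lt_def subr_ge0 fl1 andbT; apply/eqP => s0.
  have : quad r (- Num.floor r, 1) = 0 by rewrite /quad /= -s0 /s; ring.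
  by move/r_free.
have s1 : `|s| < 1 by rewrite gtr0_norm // /s; lra.
have spow n : exists p, s ^+ n = quad r p.
  elim: n => [|n [[a b] IH]]; first by exists (1, 0); rewrite /quad /=; ring.
  pose k := Num.floor r.
  exists (b * d - k * a, a + b * c - k * b).
  rewrite exprS IH /s -/k /quad /=.
  have -> : (r - k%:~R) * (a%:~R + b%:~R * r) =
    a%:~R * r + b%:~R * r ^+ 2 - k%:~R * (a%:~R + b%:~R * r) by ring.
  by rewrite rE; ring.
have [n sn] : exists n, s ^+ n < y - x.
  have /cvgr0Pnorm_lt/(_ (y - x)) := cvg_expr s1.
  rewrite subr_gt0 => /(_ xy)[n _ /(_ n (leqnn n)) /=] h.
  by exists n; exact: le_lt_trans (ler_norm _) h.
have [[a b] hp] := spow n; set e := s ^+ n in sn hp.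
have e0 : 0 < e by rewrite exprn_gt0.
pose k := Num.floor (x / e) + 1.
have /andP[k1 k2] := floor_itv (x / e); rewrite -/k in k2.
exists (k * a, k * b).
have -> : quad r (k * a, k * b) = k%:~R * e by rewrite hp /quad /=; ring.
rewrite ltr_pdivrMr // in k2; rewrite ler_pdivlMr // in k1.
by rewrite k2 /= /k intrD mulrDl mul1r; lra.
Qed.

(** If [a^2 = p b^2] with [b] nonzero, the valuation at [p] is even on the left
    and odd on the right. *)
Lemma quad_free_sqrt (R : rcfType) (p : nat) :
  prime p -> quad_free (Num.sqrt (p%:R : R)).
Proof.
move=> p_pr [a b]; rewrite /quad /= => h.
have : (a ^+ 2)%:~R = (b ^+ 2 * p%:Z)%:~R :> R.
  have -> : (a ^+ 2)%:~R = (b%:~R * Num.sqrt p%:R) ^+ 2 :> R.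
    by rewrite rmorphXn /= -sqrrN; congr (_ ^+ 2); lra.
  by rewrite exprMn sqr_sqrtr ?ler0n // rmorphM rmorphXn.
move/eqP; rewrite eqr_int => /eqP /(congr1 absz); rewrite abszM !abszX /= => ab.
have [b0|b0] := eqVneq b 0.
  by move: h; rewrite b0 mul0r addr0 => /eqP; rewrite intr_eq0 => /eqP ->.
have p0 := prime_gt0 p_pr.
have bb : (0 < `|b| ^ 2)%N by rewrite expn_gt0 absz_gt0 b0.
move: (congr1 (logn p) ab).
rewrite lognM // !lognX (logn_prime p p_pr) eqxx; lia.
Qed.

Lemma quad_free_affine (R : numDomainType) (z r : R) (k h m : int) :
  quad_free z -> k != 0 -> m != 0 -> k%:~R * r = h%:~R + m%:~R * z ->
  quad_free r.
Proof.
move=> z_free k0 m0 E [a b]; rewrite /quad /= => ab.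
have : quad z (k * a + b * h, b * m) = 0.
  rewrite /quad /=; transitivity (k%:~R * (a%:~R + b%:~R * r)); last by rewrite ab mulr0.
  have -> : k%:~R * (a%:~R + b%:~R * r) = k%:~R * a%:~R + b%:~R * (k%:~R * r) by ring.
  by rewrite E; ring.
move/z_free => [] /[swap] /eqP; rewrite mulf_eq0 (negbTE m0) orbF => /eqP ->.
by rewrite mul0r addr0 => /eqP; rewrite mulf_eq0 (negbTE k0) => /eqP ->.
Qed.

(** * Uniqueness for Schilling's problem *)

Section Analysis.
Variable R : realType.
Implicit Types (f : R -> R) (q Q t x : R).

Lemma onesided_zero f x :
  (forall y z, y < z -> exists t, y < t < z /\ f t = 0) ->
  right_continuous_at f x \/ left_continuous_at f x -> f x = 0.
Proof.
move=> f_dense fx; apply/eqP; rewrite -normr_eq0; apply: contraT => fx0.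
have {}fx0 : 0 < `|f x| by rewrite lt_def fx0 /=.
case: fx => /cvgrPdist_lt/(_ _ fx0)/nbhs_ballP[e /= e0 he].
- have [|t [/andP[xt te] ft]] := f_dense x (x + e); first by rewrite ltrDl.
  have : `|f x - f t| < `|f x|.
    by apply: he => //=; rewrite /ball /= ltr0_norm; lra.
  by rewrite ft subr0 ltxx.
- have [|t [/andP[te tx] ft]] := f_dense (x - e) x; first by rewrite ltrBlDr ltrDl.
  have : `|f x - f t| < `|f x|.
    by apply: he => //=; rewrite /ball /= gtr0_norm; lra.
  by rewrite ft subr0 ltxx.
Qed.

Lemma schilling_opp q f : schilling_solution q f -> schilling_solution q (f \o -%R).
Proof.
move=> [fE f_supp]; split=> x /=; last by move=> hx; apply: f_supp; rewrite normrN.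
rewrite -mulrN fE; congr (_ * _).
have -> : - (x - 1) = - x + 1 by ring.
have -> : - (x + 1) = - x - 1 by ring.
ring.
Qed.

(** The equation at [Q + 1], where [q (Q + 1) = Q], reduces to
    [f(Q) = f(Q) / (4 q)]. *)
Lemma schilling_endpoint q f : 0 < q < 1 -> 4 * q != 1 ->
  schilling_solution q f -> f (q / (1 - q)) = 0.
Proof.
move=> /andP[q0 q1] q4 [fE f_supp]; set Q := q / (1 - q).
have Q1 : Q + 1 = (1 - q)^-1 by rewrite /Q; field; lra.
have Q0 : 0 < Q by rewrite divr_gt0 // subr_gt0.
have := fE (Q + 1).
have -> : q * (Q + 1) = Q by rewrite Q1.
rewrite addrK (f_supp (Q + 1)) ?(f_supp (Q + 1 + 1)) -/Q ?gtr0_norm; try lra.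
rewrite mulr0 !addr0 => h; apply/eqP; apply: contraT => fQ.
case/negP: q4; apply/eqP; apply: (mulIf fQ).
by rewrite {1}h mul1r mulVKf //; lra.
Qed.

(** The step [h] is the least gain of one round: the zero set grows from
    [(Q - u, oo)] to [(Q - min (u / q) (u + 1), oo)], and
    [u / q - u >= t (1 / q - 1)] as soon as [u >= t]. *)
Lemma schilling_push q f t : 0 < q < 1 -> 0 < t ->
  schilling_solution q f -> (forall x, q / (1 - q) - t < x -> f x = 0) ->
  f = (fun=> 0).
Proof.
move=> /andP[q0 q1] t0 [fE _]; set Q := q / (1 - q) => f0.
have QE : q * (Q + 1) = Q by rewrite /Q; field; lra.
pose h := Num.min (t * (q^-1 - 1)) 1.
have h0 : 0 < h by rewrite lt_min ltr01 mulr_gt0 ?subr_gt0 ?invf_gt1.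
have [ht h1] : h <= t * (q^-1 - 1) /\ h <= 1 by rewrite !ge_min !lexx orbT.
have zero_beyond n : forall x, Q - (t + n%:R * h) < x -> f x = 0.
  elim: n => [|n IH] x; first by rewrite mul0r addr0; exact: f0.
  rewrite -natr1 mulrDl mul1r => hx.
  set u := t + n%:R * h in IH hx.
  have tu : t <= u by rewrite lerDl mulr_ge0 // ltW.
  have hu : h <= u * (q^-1 - 1).
    by apply: (le_trans ht); rewrite ler_wpM2r // subr_ge0 invf_ge1 // ltW.
  have {}hx : Q - u - h < x by rewrite /u; lra.
  have hqx : Q - u < q * (x + 1).
    have : q * (Q - u - h) < q * x by rewrite ltr_pM2l.
    have : q * (h + u) <= u.
      by rewrite -ler_pdivlMl // mulrC; move: hu; rewrite mulrBr mulr1; lra.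
    by move: QE {IH tu hu hx}; clearbody u; lra.
  have := fE (x + 1).
  rewrite addrK (IH _ hqx) (IH (x + 1)) ?(IH (x + 1 + 1)); [|lra..].
  rewrite mulr0 !addr0 => /esym/eqP; rewrite mulf_eq0 invr_eq0 => /orP[|/eqP//].
  by rewrite mulf_eq0; lra.
apply: boolp.funext => x; apply: (zero_beyond (Num.bound ((`|Q| + `|x|) / h))).
have : (`|Q| + `|x|) / h < (Num.bound ((`|Q| + `|x|) / h))%:R.
  by apply: archi_boundP; rewrite divr_ge0 ?addr_ge0 // ltW.
rewrite ltr_pdivrMr // => hb.
have := ler_norm Q; have := ler_norm (- x); rewrite normrN; lra.
Qed.

(** Uniqueness for every [q] that is the inverse of a quadratic Pisot number.
    The case of the left interval is the case of the right one for
    [x |-> f (- x)]. *)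
Theorem schilling_pisot (q r r' : R) (c d : int) (delta : R) (f : R -> R) :
  1 < r -> q * r = 1 -> `|r'| < 1 -> quad_free r ->
  r ^+ 2 = c%:~R * r + d%:~R -> r' ^+ 2 = c%:~R * r' + d%:~R ->
  schilling_solution q f -> 0 < delta ->
  (forall x, q / (1 - q) - delta < x < q / (1 - q) ->
    right_continuous_at f x \/ left_continuous_at f x) \/
  (forall x, - (q / (1 - q)) < x < - (q / (1 - q)) + delta ->
    right_continuous_at f x \/ left_continuous_at f x) ->
  f = (fun=> 0).
Proof.
move=> r1 qr r'1 r_free rE r'E sf delta0 cf.
have r0 : 0 < r by lra.
have qE : q = r^-1 by rewrite mulrC in qr; rewrite (mulr1_eq qr).
have q01 : 0 < q < 1 by rewrite qE invr_gt0 r0 invf_lt1.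
(* [4 q = 1] would make [r] an integer *)
have q4 : 4 * q != 1.
  apply/eqP => h; have /r_free : quad r (-4, 1) = 0; last by [].
  move: h; rewrite qE => /(canRL (divfK (lt0r_neq0 r0))) h.
  by rewrite /quad /=; lra.
have rr' : r != r'.
  by apply/eqP => E; move: r'1; rewrite -E gtr0_norm // ltNge ltW.
have f_quad p : f (quad r p) = 0.
  have [fE f_supp] := sf.
  apply: (vanish_on_quad rE r'E r_free r'1 _ f_supp p rr') => y.
  have := fE (r * y); rewrite qE mulKf ?gt_eqF // => ->.
  by field; rewrite gt_eqF.
have f_dense y z : y < z -> exists t, y < t < z /\ f t = 0.
  by move=> yz; have [p hp] := quad_dense rE r_free yz; exists (quad r p).
set Q := q / (1 - q) in cf.
have main g : schilling_solution q g ->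
    (forall x, Q - delta < x < Q -> g x = 0) -> g = (fun=> 0).
  move=> sg g0; apply: (schilling_push q01 delta0 sg) => x hx.
  have [xQ|Qx|->] := ltgtP x Q.
  - by apply: g0; rewrite hx.
  - by have [_] := sg; apply; rewrite (lt_le_trans Qx) // ler_norm.
  - exact: schilling_endpoint.
case: cf => cf; first by apply: main => // x hx; apply: (onesided_zero f_dense); exact: cf.
have g0 : f \o -%R = (fun=> 0).
  apply: main; first exact: schilling_opp.
  by move=> x /andP[h1 h2] /=; apply: (onesided_zero f_dense); apply: cf; lra.
by apply: boolp.funext => x; have := congr1 (fun g => g (- x)) g0; rewrite /= opprK.
Qed.

End Analysis.

Unset Implicit Arguments.
Set Strict Implicit.

Theorem mainTheorem2 (R : realType) (q : R)
  (hq : q \in [:: (Num.sqrt 3 - 1) / 2; (3 - Num.sqrt 5) / 2;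
                  Num.sqrt 2 - 1; (Num.sqrt 5 - 1) / 2])
  (Q : R) (hQ : Q = q / (1 - q))
  (delta : R) (hdelta : 0 < delta)
  (I : set R)
  (hI : I = `]- Q, - Q + delta[%classic \/ I = `]Q - delta, Q[%classic)
  (f : R -> R) :
  (schilling_solution q f /\
   (forall x : R, I x -> right_continuous_at f x \/ left_continuous_at f x))
  <-> f = (fun=> 0).
Proof.
split=> [[sf cf]|->]; last first.
  split; last by move=> x _; left; exact: cvg_cst.
  by split=> // x; ring.
have {}cf :
    (forall x, q / (1 - q) - delta < x < q / (1 - q) ->
      right_continuous_at f x \/ left_continuous_at f x) \/
    (forall x, - (q / (1 - q)) < x < - (q / (1 - q)) + delta ->
      right_continuous_at f x \/ left_continuous_at f x).
  rewrite -hQ; case: hI => IE; [right|left] => x hx; apply: cf.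
    by rewrite IE /= in_itv.
  by rewrite IE /= in_itv.
have sq (n : nat) : (0 : R) <= Num.sqrt n%:R /\ (Num.sqrt n%:R) ^+ 2 = n%:R :> R.
  by rewrite sqrtr_ge0 sqr_sqrtr ?ler0n.
have free (p : nat) (r : R) (k h m : int) : prime p -> k != 0 -> m != 0 ->
    k%:~R * r = h%:~R + m%:~R * Num.sqrt p%:R -> quad_free r.
  by move=> /(@quad_free_sqrt R _); exact: quad_free_affine.
have [s20 s2] := sq 2; have [s30 s3] := sq 3; have [s50 s5] := sq 5.
have free2 r k h m := free 2%N r k h m isT.
have free3 r k h m := free 3%N r k h m isT.
have {sq free} free5 r k h m := free 5%N r k h m isT.
move: s20 s2 s30 s3 s50 s5 free2 free3 free5 hq; rewrite !inE.
move: (Num.sqrt 2) (Num.sqrt 3) (Num.sqrt 5) => s t u.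
move=> s0 sE t0 tE u0 uE free2 free3 free5 hq.
have hs : 1 < s < 2 by apply/andP; split; nra.
have ht : 1 < t < 2 by apply/andP; split; nra.
have hu : 2 < u < 3 by apply/andP; split; nra.
(* in each case r = 1 / q is a root of X^2 - c X - d, and r' is its conjugate *)
case/or4P: hq => /eqP qE.
- apply: (@schilling_pisot R q (1 + t) (1 - t) 2 2 delta) => //; try nra.
  + by rewrite ltr_norml; lra.
  + by apply: (free3 _ 1 1 1) => //; ring.
- apply: (@schilling_pisot R q ((3 + u) / 2) ((3 - u) / 2) 3 (-1) delta) => //; try nra.
  + by rewrite ltr_norml; lra.
  + by apply: (free5 _ 2 3 1) => //; field.
- apply: (@schilling_pisot R q (1 + s) (1 - s) 2 1 delta) => //; try nra.
  + by rewrite ltr_norml; lra.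
  + by apply: (free2 _ 1 1 1) => //; ring.
- apply: (@schilling_pisot R q ((1 + u) / 2) ((1 - u) / 2) 1 1 delta) => //; try nra.
  + by rewrite ltr_norml; lra.
  + by apply: (free5 _ 2 1 1) => //; field.
Qed.
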